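(* Let $m,L,R\ge1$ be integers and let $(p^{(r)},w^{(r)})$, $1\le r\le R$, be kernel--boundary pairs, every one of which is scalar-feasible. If $\lambda_r\ge0$ for $1\le r\le R$ and $\sum_{r=1}^R\lambda_r=1$, then \[ \sqrt{ab}\ge\min_{r:\lambda_r>0}\sqrt{a_rb_r}. \]
   Context: A kernel vector is a symmetric probability vector $p=(p_0,\ldots,p_{m-1})$ of real numbers: $p_i\ge0$, $\sum_{i=0}^{m-1}p_i=1$, $p_i=p_{m-1-i}$. A boundary vector is a real vector $w=(w_0,\ldots,w_{Lm-1})$, extended by the convention $w_j=1$ for every $j\ge Lm$. A kernel--boundary pair $(p,w)$ consists of a kernel vector and a boundary vector. The pair $(p,w)$ is scalar-feasible if \[ \sum_{i=0}^{m-1}p_iw_{q+i}\ge1\qquad\text{for all integers }0\le q\le Lm. \] For kernel--boundary pairs $(p^{(r)},w^{(r)})$, $1\le r\le R$, put \[ a_r:=m\sum_{i=0}^{m-1}\bigl(p_i^{(r)}\bigr)^2, \qquad b_r:=1+2\left(\frac1m\sum_{j=0}^{Lm-1}\bigl(w_j^{(r)}\bigr)^2-L\right). \] For weights $\lambda_1,\ldots,\lambda_R$ as in the claim, put \[ a:=m\sum_{r=1}^R\lambda_r\sum_{i=0}^{m-1}\bigl(p_i^{(r)}\bigr)^2, \qquad b:=1+2\left(\frac1m\sum_{r=1}^R\lambda_r\sum_{j=0}^{Lm-1}\bigl(w_j^{(r)}\bigr)^2-L\right). \] (Scalar feasibility implies $b_r\ge 1/m>0$, so all square roots are of nonnegative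 reals.) *)

(* Defs.v *)
From mathcomp Require Import all_boot all_order all_algebra.
From mathcomp Require Import reals.

Set Implicit Arguments.
Unset Strict Implicit.
Unset Printing Implicit Defensive.

Import Order.TTheory GRing.Theory Num.Theory.
Local Open Scope ring_scope.

Definition is_kernel_vector (R : realType) (m : nat) (p : 'rV[R]_m) : Prop :=
  [/\ forall i : 'I_m, 0 <= p 0 i,
      \sum_(i < m) p 0 i = 1
    & forall i : 'I_m, p 0 i = p 0 (rev_ord i)].

Definition boundary_ext (R : realType) (n : nat) (w : 'rV[R]_n) (j : nat) : R :=
  if insub j is Some i then w 0 i else 1.

Definition scalar_feasible (R : realType) (m L : nat)
    (p : 'rV[R]_m) (w : 'rV[R]_(L * m)) : Prop :=
  forall q : nat, (q <= L * m)%N ->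
    1 <= \sum_(i < m) p 0 i * boundary_ext w (q + i).

Definition a_pair (R : realType) (m : nat) (p : 'rV[R]_m) : R :=
  m%:R * \sum_(i < m) p 0 i ^+ 2.

Definition b_pair (R : realType) (m L : nat) (w : 'rV[R]_(L * m)) : R :=
  1 + 2 * (m%:R^-1 * (\sum_(j < L * m) w 0 j ^+ 2) - L%:R).

Definition a_mix (R : realType) (m N : nat) (lambda : 'I_N -> R)
    (p : 'I_N -> 'rV[R]_m) : R :=
  m%:R * \sum_(r < N) lambda r * \sum_(i < m) p r 0 i ^+ 2.

Definition b_mix (R : realType) (m L N : nat) (lambda : 'I_N -> R)
    (w : 'I_N -> 'rV[R]_(L * m)) : R :=
  1 + 2 * (m%:R^-1 *
             (\sum_(r < N) lambda r * \sum_(j < L * m) w r 0 j ^+ 2) - L%:R).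

(* The value is the junk 0 when P is empty; otherwise it is the genuine
   minimum, see finite_minP. *)
Definition finite_min (R : realType) (I : finType) (P : pred I) (F : I -> R) : R :=
  if [pick i | P i] is Some i0 then F [arg min_(i < i0 | P i) F i]%O else 0.

Lemma finite_minP (R : realType) (I : finType) (P : pred I) (F : I -> R) :
  (exists i, P i) ->
  (exists2 i, P i & finite_min P F = F i) /\
  (forall i, P i -> finite_min P F <= F i).
Proof.
case=> k Pk; rewrite /finite_min; case: pickP => [i0 Pi0|/(_ k)]; last first.
  by rewrite Pk.
by case: arg_minP => // i Pi lei; split=> //; exists i.
Qed.

(* Main.v *)
(** By Cauchy-Schwarz, [sqrt (a b)] dominates the [lambda]-average of the
    [sqrt (a_r b_r)], hence their minimum, as soon as all [b_r] are nonnegative.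
    For the latter, average the [Lm] feasibility conditions [q < Lm]: since
    [2 x - 1 <= x ^+ 2] and shifting the extended [w] by [i] replaces at most [i]
    squares by ones, [Lm] is at most [sum w_j^2 + sum p_i i], and
    the mean [sum p_i i] is [(m - 1) / 2] by symmetry. *)
Require Import Defs.
From mathcomp Require Import all_boot all_order all_algebra.
From mathcomp Require Import reals.
From mathcomp Require Import ring lra.

Set Implicit Arguments.
Unset Strict Implicit.
Unset Printing Implicit Defensive.

Import Order.TTheory GRing.Theory Num.Theory.
Local Open Scope ring_scope.

(** Each further unit of shift drops the term [f i], which is nonnegative, and gains [f (n + i)],
    which is 1. *)
Lemma sum_shift_le (R : numDomainType) (n i : nat) (f : nat -> R) :
  (forall j, 0 <= f j) -> (forall j, (n <= j)%N -> f j = 1) ->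
  \sum_(q < n) f (q + i)%N <= \sum_(q < n) f q + i%:R.
Proof.
move=> f0 f1; elim: i => [|i IH].
  by rewrite addr0; apply: ler_sum => q _; rewrite addn0.
apply: (@le_trans _ _ (\sum_(q < n) f (q + i)%N + 1)); last first.
  by rewrite -natr1 addrA lerD2r.
have -> : \sum_(q < n) f (q + i.+1)%N =
    \sum_(q < n) f (q + i)%N + f (n + i)%N - f i.
  rewrite -(big_ord_recr n (fun q => f (q + i)%N)) big_ord_recl add0n addrC addKr.
  by apply: eq_bigr => q _; rewrite /= addnS.
by rewrite f1 ?leq_addr // gerBl.
Qed.

Lemma boundary_ext_ord (R : realType) (n : nat) (w : 'rV[R]_n) (j : 'I_n) :
  boundary_ext w j = w 0 j.
Proof. by rewrite /boundary_ext valK. Qed.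

Lemma boundary_ext_out (R : realType) (n : nat) (w : 'rV[R]_n) (j : nat) :
  (n <= j)%N -> boundary_ext w j = 1.
Proof. by move=> nj; rewrite /boundary_ext insubF // ltnNge nj. Qed.

(** Reversal preserves the weights and sends [i] to [m - 1 - i], so adding the sum to its reversal
    gives each weight the factor [m - 1]. *)
Lemma kernel_mean (R : realType) (m : nat) (p : 'rV[R]_m) :
  is_kernel_vector p -> 2 * \sum_(i < m) p 0 i * i%:R = m%:R - 1.
Proof.
case=> _ p1 psym; rewrite mulr2n mulrDl mul1r.
rewrite {2}(reindex_inj rev_ord_inj) -big_split /=.
rewrite -[RHS]mul1r -[X in _ = X * _]p1 mulr_suml; apply: eq_bigr => i _.
by rewrite -psym -mulrDr /= natrB // -natr1; congr (_ * _); ring.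
Qed.

Lemma b_pair_ge (R : realType) (m L : nat) (p : 'rV[R]_m) (w : 'rV[R]_(L * m)) :
  (0 < m)%N -> is_kernel_vector p -> scalar_feasible p w ->
  m%:R^-1 <= b_pair w.
Proof.
move=> m0 hp hw; have hmean := kernel_mean hp; case: hp => p0 p1 _.
have shift (i : 'I_m) : \sum_(q < L * m) boundary_ext w (q + i) *+ 2 - (L * m)%:R
    <= \sum_(j < L * m) w 0 j ^+ 2 + i%:R.
  have := @sum_shift_le R (L * m) i (fun j => boundary_ext w j ^+ 2)
    (fun j => sqr_ge0 _).
  under [X in X + _]eq_bigr do rewrite boundary_ext_ord.
  move=> h; apply: le_trans (h _) => [|j nj]; last first.
    by rewrite boundary_ext_out ?expr1n.
  rewrite -[X in X%:R]card_ord -sumr_const -sumrB; apply: ler_sum => q _.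
  by have := sqr_ge0 (boundary_ext w (q + i) - 1); lra.
have feas : (L * m)%:R <=
    \sum_(i < m) p 0 i * \sum_(q < L * m) boundary_ext w (q + i).
  under eq_bigr do rewrite mulr_sumr.
  rewrite exchange_big /= -[X in X%:R <= _]card_ord -sumr_const.
  by apply: ler_sum => q _; apply: hw; apply: ltnW.
have avg : \sum_(i < m) p 0 i *
      (\sum_(q < L * m) boundary_ext w (q + i) *+ 2 - (L * m)%:R)
    <= \sum_(i < m) p 0 i * (\sum_(j < L * m) w 0 j ^+ 2 + i%:R).
  by apply: ler_sum => i _; rewrite ler_wpM2l.
move: avg; under eq_bigr do rewrite mulrBr sumrMnl mulrnAr.
under [X in _ <= X]eq_bigr do rewrite mulrDr.
rewrite sumrB sumrMnl big_split /= -!mulr_suml p1 !mul1r => avg.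
have m_gt0 : 0 < m%:R :> R by rewrite ltr0n.
(* With W the sum of squares, [feas], [avg] and [hmean] give Lm <= W + (m - 1)/2; hence m times
   [b_pair w], which is m + 2W - 2Lm, is at least 1. *)
rewrite /b_pair -(ler_pM2l m_gt0) divff ?gt_eqF //.
have -> : m%:R * (1 + 2 * (m%:R^-1 * (\sum_(j < L * m) w 0 j ^+ 2) - L%:R)) =
    m%:R + 2 * (\sum_(j < L * m) w 0 j ^+ 2) - 2 * (L * m)%:R.
  by rewrite natrM; field; rewrite gt_eqF.
by lra.
Qed.

Lemma sum_sqrt_le (R : rcfType) (I : finType) (c x y : I -> R) :
  (forall i, 0 <= c i) -> (forall i, 0 <= x i) -> (forall i, 0 <= y i) ->
  \sum_i c i * Num.sqrt (x i * y i)
  <= Num.sqrt ((\sum_i c i * x i) * (\sum_i c i * y i)).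
Proof.
move=> c0 x0 y0.
have S0 : 0 <= \sum_i c i * Num.sqrt (x i * y i).
  by apply: sumr_ge0 => i _; rewrite mulr_ge0 ?sqrtr_ge0.
rewrite -(ger0_norm S0) -sqrtr_sqr ler_wsqrtr // expr2.
(* Doubling and swapping the factors of one copy symmetrises the double sum in [i] and [j], so that
   Cauchy-Schwarz holds term by term. *)
rewrite -(ler_pMn2r (isT : (0 < 2)%N)) [leRHS]mulr2n [X in _ <= _ + X]mulrC.
rewrite !big_distrlr /= -sumrMnl -big_split /=; apply: ler_sum => i _.
rewrite -sumrMnl -big_split /=; apply: ler_sum => j _.
rewrite !sqrtrM //.
(* The first occurrence is under a root; only the bare one becomes a square. *)
rewrite -{2}(sqr_sqrtr (x0 i)) -{2}(sqr_sqrtr (x0 j)).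
rewrite -{2}(sqr_sqrtr (y0 i)) -{2}(sqr_sqrtr (y0 j)).
set xi := Num.sqrt (x i); set xj := Num.sqrt (x j).
set yi := Num.sqrt (y i); set yj := Num.sqrt (y j).
rewrite -subr_ge0.
have := mulr_ge0 (mulr_ge0 (c0 i) (c0 j)) (sqr_ge0 (xi * yj - xj * yi)).
by congr (0 <= _); ring.
Qed.

Lemma a_pair_ge0 (R : realType) (m : nat) (p : 'rV[R]_m) : 0 <= a_pair p.
Proof. by rewrite mulr_ge0 // sumr_ge0 // => i _; apply: sqr_ge0. Qed.

Lemma a_mixE (R : realType) (m N : nat) (lambda : 'I_N -> R)
    (p : 'I_N -> 'rV[R]_m) :
  a_mix lambda p = \sum_(r < N) lambda r * a_pair (p r).
Proof. by rewrite /a_mix mulr_sumr; apply: eq_bigr => r _; rewrite mulrCA. Qed.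

(** [b_pair] is affine in the sum of squares, and weights of total 1 preserve its constant term. *)
Lemma b_mixE (R : realType) (m L N : nat) (lambda : 'I_N -> R)
    (w : 'I_N -> 'rV[R]_(L * m)) :
  \sum_(r < N) lambda r = 1 ->
  b_mix lambda w = \sum_(r < N) lambda r * b_pair (w r).
Proof.
move=> l1; rewrite /b_mix /b_pair.
under [RHS]eq_bigr do rewrite mulrDr mulr1 mulrCA mulrBr [lambda _ * (_ * _)]mulrCA.
by rewrite big_split /= l1 -mulr_sumr sumrB -mulr_sumr -mulr_suml l1 mul1r.
Qed.

Theorem proposition2p2 (R : realType) (m L N : nat)
    (hm : (1 <= m)%N) (hL : (1 <= L)%N) (hN : (1 <= N)%N)
    (p : 'I_N -> 'rV[R]_m) (w : 'I_N -> 'rV[R]_(L * m))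
    (hp : forall r : 'I_N, is_kernel_vector (p r))
    (hpw : forall r : 'I_N, scalar_feasible (p r) (w r))
    (lambda : 'I_N -> R)
    (lambda_ge0 : forall r : 'I_N, 0 <= lambda r)
    (lambda_sum1 : \sum_(r < N) lambda r = 1) :
  finite_min (fun r : 'I_N => 0 < lambda r)
             (fun r : 'I_N => Num.sqrt (a_pair (p r) * b_pair (w r)))
  <= Num.sqrt (a_mix lambda p * b_mix lambda w).
Proof.
have b0 r : 0 <= b_pair (w r).
  by apply: le_trans (b_pair_ge hm (hp r) (hpw r)); rewrite invr_ge0.
rewrite a_mixE b_mixE //.
apply: le_trans (sum_sqrt_le lambda_ge0 (fun r => a_pair_ge0 (p r)) b0).
have [r0 lr0|none] := pickP (fun r => 0 < lambda r); last first.
(* Without a positive weight, [finite_min] takes its default 0. *)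
- rewrite /finite_min; case: pickP => [r|_]; first by rewrite none.
  by apply: sumr_ge0 => r _; rewrite mulr_ge0 ?sqrtr_ge0.
have [_ min_le] := @finite_minP R _ (fun r => 0 < lambda r)
  (fun r => Num.sqrt (a_pair (p r) * b_pair (w r))) (ex_intro _ r0 lr0).
(* The minimum is its own weighted average; indices of weight zero contribute 0 to both sides. *)
rewrite -[leLHS]mul1r -lambda_sum1 mulr_suml; apply: ler_sum => r _.
have := lambda_ge0 r; rewrite le_eqVlt => /predU1P[<-|lr]; first by rewrite !mul0r.
by rewrite ler_pM2l // min_le.
Qed.
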